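(* Let $(\varPhi,\boldsymbol{y})$ be a relatively normalized surface of constant positive relative curvature $K$ in the Euclidean space $\mathbb{E}^3$. Then there are two relatively parallel surfaces to $(\varPhi,\boldsymbol{y})$ which have constant relative mean curvature.
   Context: Let $U\subset\mathbb{R}^2$ be a region and $\varPhi$ a $C^r$-surface in $\mathbb{E}^3$, $r\ge 3$, given by an injective $C^r$-immersion $\boldsymbol{x}=\boldsymbol{x}(u^1,u^2)$ on $U$ whose Gaussian curvature never vanishes. Write $\partial_i=\partial/\partial u^i$; repeated indices are summed over $1,2$. A $C^s$-relative normalization of $\varPhi$ ($r>s\ge1$) is a $C^s$-map $\boldsymbol{y}:U\to\mathbb{R}^3$ such that everywhere on $U$: $\operatorname{rank}\{\partial_1\boldsymbol{x},\partial_2\boldsymbol{x},\boldsymbol{y}\}=3$ and $\operatorname{rank}\{\partial_1\boldsymbol{x},\partial_2\boldsymbol{x},\partial_i\boldsymbol{y}\}=2$ for $i=1,2$. The pair $(\varPhi,\boldsymbol{y})$ is called a relatively normalized surface. The functions $B_i^j$ are defined by $\partial_i\boldsymbol{y}=-B_i^j\,\partial_j\boldsymbol{x}$. The eigenvalues $\kappa_1,\kappa_2$ of $(B_i^j)$ are the relative principal curvatures; the relative curvature is $K=\kappa_1\kappa_2=\det(B_i^j)$ and the relative mean curvature is $H$, where $2H=\kappa_1+\kappa_2=B_i^i$. It is assumed throughout that the relative lines of curvature (the curves on $\varPhi$ along which the lines in direction $\boldsymbol{y}$ form developable surfaces) are real, so that $H^2-K\ge0$. For a real constant $\mu\neq0$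 such that $A:=\mu^2K-2\mu H+1\neq0$ everywhere on $U$, the surface $\varPhi^*$ parametrized by $\boldsymbol{x}^*=\boldsymbol{x}+\mu\,\boldsymbol{y}$ is regular and $\boldsymbol{y}$ is also a relative normalization of it; $(\varPhi^*,\boldsymbol{y})$ is called the relatively parallel surface to $(\varPhi,\boldsymbol{y})$ at relative distance $\mu$. Different values of $\mu$ give different relatively parallel surfaces. The relative mean curvature $H^*$ of $(\varPhi^*,\boldsymbol{y})$ is obtained by replacing $\boldsymbol{x}$ by $\boldsymbol{x}^*$ in the definitions above: $2H^*=B^{*i}_{\ i}$, where $\partial_i\boldsymbol{y}=-B^{*j}_{\ i}\,\partial_j\boldsymbol{x}^*$.
   Formalization: The literal claim fails if H is non-constant and the surface has relative umbilics (H^2=K): one of the two parallel surfaces is singular there. Proved: one is regular with constant H* on all of U, the other on U minus those umbilics (on all of U if H is constant or there are no umbilics). *)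

(* Defs.v *)
From HB Require Import structures.
From mathcomp Require Import all_boot all_order all_algebra.
From mathcomp Require Import all_classical all_reals all_analysis.
Import Order.TTheory GRing.Theory Num.Theory.
Import numFieldNormedType.Exports.

Set Implicit Arguments.
Unset Strict Implicit.
Unset Printing Implicit Defensive.

Local Open Scope classical_set_scope.
Local Open Scope ring_scope.

Definition region (R : realType) (U : set 'rV[R]_2) : Prop :=
  [/\ U !=set0, open U & connected U].

Definition partial (R : realType) (m : nat) (i : 'I_2)
    (f : 'rV[R]_2 -> 'rV[R]_m.+1) : 'rV[R]_2 -> 'rV[R]_m.+1 :=
  fun u => 'D_(delta_mx 0 i) f u.

(* Only meaningful for U open: the partial derivatives at a point of U then
   depend on the values of f on U only. *)
Fixpoint class_C (R : realType) (m k : nat) (U : set 'rV[R]_2)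
    (f : 'rV[R]_2 -> 'rV[R]_m.+1) : Prop :=
  (forall u, U u -> {for u, continuous f}) /\
  match k with
  | 0%N => True
  | k'.+1 => forall i : 'I_2,
      (forall u, U u -> derivable f u (delta_mx 0 i)) /\
      class_C k' U (partial i f)
  end.

Definition rank3 (R : realType) (a b c : 'rV[R]_3) : nat :=
  \rank (col_mx a (col_mx b c)).

Definition dot (R : realType) (a b : 'rV[R]_3) : R := (a *m b^T) 0 0.

Definition cross (R : realType) (a b : 'rV[R]_3) : 'rV[R]_3 :=
  \row_(k < 3) \det (col_mx (delta_mx 0 k : 'rV[R]_3) (col_mx a b)).

Section Surface.
Variable R : realType.
Implicit Types (U V : set 'rV[R]_2) (x y : 'rV[R]_2 -> 'rV[R]_3).
Implicit Types (u : 'rV[R]_2) (mu : R).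

Definition immersion_on U x : Prop :=
  forall u, U u ->
    \rank (col_mx (partial 0 x u) (partial 1 x u)) = 2%N.

Definition unit_normal x u : 'rV[R]_3 :=
  let n := cross (partial 0 x u) (partial 1 x u) in
  (Num.sqrt (dot n n))^-1 *: n.

Definition first_form x u : 'M[R]_2 :=
  \matrix_(i, j) dot (partial i x u) (partial j x u).

Definition second_form x u : 'M[R]_2 :=
  \matrix_(i, j) dot (partial j (partial i x) u) (unit_normal x u).

Definition gauss_curvature x u : R :=
  \det (second_form x u) / \det (first_form x u).

Definition surface (r : nat) U x : Prop :=
  [/\ class_C r U x, {in U &, injective x}, immersion_on U x &
      forall u, U u -> gauss_curvature x u != 0].

Definition relative_normalization (s : nat) U x y : Prop :=
  class_C s U y /\
  forall u, U u ->
    rank3 (partial 0 x u) (partial 1 x u) (y u) = 3%N /\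
    forall i : 'I_2,
      rank3 (partial 0 x u) (partial 1 x u) (partial i y u) = 2%N.

(* Row i, column j holds B_i^j, where y_{/i} = - B_i^j x_{/j}. *)
Definition is_shape_matrix x y u (B : 'M[R]_2) : Prop :=
  forall i : 'I_2, partial i y u = - \sum_(j < 2) B i j *: partial j x u.

(* When y is a relative normalization of x such a matrix exists and, x being
   an immersion, it is unique; 0 is a dummy value used elsewhere. *)
Definition shape_matrix x y u : 'M[R]_2 :=
  xget 0 [set B | is_shape_matrix x y u B].

Definition relative_curvature x y u : R := \det (shape_matrix x y u).

Definition relative_mean_curvature x y u : R := \tr (shape_matrix x y u) / 2.

Definition constant_on U (f : 'rV[R]_2 -> R) : Prop :=
  exists c : R, forall u, U u -> f u = c.

Definition parallel_map x y mu : 'rV[R]_2 -> 'rV[R]_3 :=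
  fun u => x u + mu *: y u.

Definition parallel_factor x y mu u : R :=
  mu ^+ 2 * relative_curvature x y u
    - 2 * mu * relative_mean_curvature x y u + 1.

Definition relatively_parallel_on V x y mu : Prop :=
  mu != 0 /\ forall u, V u -> parallel_factor x y mu u != 0.

Definition parallel_cmc_on V x y mu : Prop :=
  relatively_parallel_on V x y mu /\
  constant_on V (relative_mean_curvature (parallel_map x y mu) y).

(* The relative umbilics (H ^ 2 = K) of a surface whose H is not constant.
   If K > 0 is constant and H is not, the relative mean curvature of the
   parallel surface is constant only for mu = 1 / sqrt K and
   mu = - 1 / sqrt K.  One of these two surfaces is regular everywhere; the
   factor of the other one vanishes exactly at the relative umbilics.  The set
   is empty if there are no relative umbilics, or if H is constant (then both
   surfaces can be chosen to be regular everywhere). *)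
Definition exceptional_umbilics U x y : set 'rV[R]_2 :=
  [set u | [/\ U u,
    relative_mean_curvature x y u ^+ 2 = relative_curvature x y u &
    ~ constant_on U (relative_mean_curvature x y)]].

End Surface.

(* Main.v *)
(** With [2H] and [K] the trace and determinant of [B], the shape matrix of the
    surface at distance [mu] is [B (1 - mu B)^-1], so that
    [2H* = (2H - 2 mu K) / A] where [A = det (1 - mu B) = 1 - 2 mu H + mu^2 K].
    If [mu^2 K = 1] this is the constant [- 1 / mu], wherever [A = 2 (1 - mu H)]
    does not vanish.  Since [H^2 >= K > 0], the continuous function [H] has a
    constant sign on the connected set [U]: the root [mu] of sign opposite to
    [H] always gives a regular surface, the other one does so away from the
    points where [H^2 = K].  If [H] is constant, any [mu] with [A <> 0] will do. *)
Require Import Defs.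
From HB Require Import structures.
From mathcomp Require Import all_boot all_order all_algebra.
From mathcomp Require Import all_classical all_reals all_analysis.
From mathcomp Require Import ring lra.
Import Order.TTheory GRing.Theory Num.Theory.
Import numFieldNormedType.Exports.

Set Implicit Arguments.
Unset Strict Implicit.
Unset Printing Implicit Defensive.

Local Open Scope classical_set_scope.
Local Open Scope ring_scope.

(** * Shape matrices through Jacobians, with the partial derivatives as rows *)

Definition jac (R : realType) (m : nat) (f : 'rV[R]_2 -> 'rV[R]_m.+1)
    (u : 'rV[R]_2) : 'M[R]_(2, m.+1) :=
  \matrix_(i < 2) partial i f u.

Lemma row_jac (R : realType) (m : nat) (f : 'rV[R]_2 -> 'rV[R]_m.+1) u i :
  row i (jac f u) = partial i f u.
Proof. exact: rowK. Qed.

Lemma col_mx_partial (R : realType) (m : nat) (f : 'rV[R]_2 -> 'rV[R]_m.+1) u :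
  col_mx (partial 0 f u) (partial 1 f u) = jac f u.
Proof.
apply/matrixP => i j; rewrite !mxE; case: splitP => k; rewrite ord1 => ik.
  by congr (partial _ f u 0 j); apply/val_inj; rewrite /= ik.
by congr (partial _ f u 0 j); apply/val_inj; rewrite /= ik.
Qed.

Lemma is_shape_matrixE (R : realType) (x y : 'rV[R]_2 -> 'rV[R]_3) u B :
  is_shape_matrix x y u B <-> jac y u = - (B *m jac x u).
Proof.
have rowE i : \sum_(j < 2) B i j *: partial j x u = row i (B *m jac x u).
  rewrite row_mul mulmx_sum_row; apply: eq_bigr => j _.
  by rewrite mxE row_jac.
split=> [hB|hB i].
  by apply/row_matrixP => i; rewrite row_jac hB rowE linearN.
by rewrite rowE -row_jac hB linearN.
Qed.

Lemma shape_matrix_unique (R : realType) (x y : 'rV[R]_2 -> 'rV[R]_3) u B B' :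
  row_free (jac x u) ->
  is_shape_matrix x y u B -> is_shape_matrix x y u B' -> B = B'.
Proof.
move=> fx /is_shape_matrixE hB /is_shape_matrixE.
by rewrite hB => /oppr_inj /(row_free_inj fx).
Qed.

Lemma shape_matrix_eq (R : realType) (x y : 'rV[R]_2 -> 'rV[R]_3) u B :
  row_free (jac x u) -> is_shape_matrix x y u B -> shape_matrix x y u = B.
Proof.
move=> fx hB; apply: (shape_matrix_unique fx _ hB).
by rewrite /shape_matrix; apply: (@xgetPex _ 0 [set B | is_shape_matrix x y u B]);
  exists B.
Qed.

(** Adding [c] does not raise the rank, so the larger row space equals the smaller one it
    contains. *)
Lemma submx_rank3 (R : realType) (a b c : 'rV[R]_3) :
  \rank (col_mx a b) = 2%N -> rank3 a b c = 2%N -> (c <= col_mx a b)%MS.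
Proof.
rewrite /rank3 => hab habc.
have sab : (col_mx a b <= col_mx a (col_mx b c))%MS.
  by rewrite -!addsmxE addsmxS // -addsmxE addsmxSl.
have : (col_mx a (col_mx b c) <= col_mx a b)%MS.
  by rewrite -(mxrank_leqif_sup sab) hab habc.
apply: submx_trans; rewrite -addsmxE; apply: (submx_trans _ (addsmxSr _ _)).
by rewrite -addsmxE addsmxSr.
Qed.

Section RelativeNormalization.
Variables (R : realType) (r s : nat) (U : set 'rV[R]_2).
Variables x y : 'rV[R]_2 -> 'rV[R]_3.
Hypotheses (hx : surface r.+1 U x) (hy : relative_normalization s.+1 U x y).

Lemma jac_free u : U u -> row_free (jac x u).
Proof.
by case: hx => _ _ im _ Uu; rewrite /row_free -col_mx_partial im.
Qed.

(** The second rank condition puts each partial derivative of [y] in the tangent plane; [pinvmx]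
    reads off its coefficients there. *)
Lemma shape_matrixP u : U u -> is_shape_matrix x y u (shape_matrix x y u).
Proof.
move=> Uu; have [_ /(_ u Uu) [_ ry]] := hy.
apply: (@xgetPex _ 0 [set B | is_shape_matrix x y u B]).
have sub : (jac y u <= jac x u)%MS.
  apply/row_subP => i; rewrite row_jac -col_mx_partial.
  by apply: submx_rank3 (ry i); rewrite col_mx_partial; apply/eqP/jac_free.
exists (- (jac y u *m pinvmx (jac x u))); apply/is_shape_matrixE.
by rewrite mulNmx opprK mulmxKpV.
Qed.

Lemma jac_parallel mu u : U u ->
  jac (parallel_map x y mu) u =
  (1%:M - mu *: shape_matrix x y u) *m jac x u.
Proof.
move=> Uu; have /is_shape_matrixE By := shape_matrixP Uu.
rewrite mulmxBl mul1mx -scalemxAl -scalerN -By.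
apply/row_matrixP => i; rewrite linearD linearZ row_jac /partial.
have [[_ dx] _ _ _] := hx; have [[_ dy] _] := hy.
have [dxi _] := dx i; have [dyi _] := dy i.
have dmy : derivable (mu \*: y) u (delta_mx 0 i) by exact/derivableZ/dyi.
rewrite /parallel_map (deriveD (dxi _ Uu) dmy) (deriveZ mu (dyi _ Uu)).
by rewrite /= !row_jac.
Qed.

End RelativeNormalization.

(** * Trace and determinant of two-by-two matrices *)

Lemma sum_ord2 (R : nmodType) (F : 'I_2 -> R) : \sum_i F i = F 0 + F 1.
Proof.
by rewrite !big_ord_recl big_ord0 addr0; congr (_ + F _); apply/val_inj.
Qed.

Lemma mxtrace2 (R : pzRingType) (B : 'M[R]_2) : \tr B = B 0 0 + B 1 1.
Proof.
exact: sum_ord2.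
Qed.

Lemma det_mx22 (R : comPzRingType) (B : 'M[R]_2) :
  \det B = B 0 0 * B 1 1 - B 0 1 * B 1 0.
Proof.
rewrite (expand_det_row _ 0) sum_ord2 /cofactor !det_mx11 !mxE.
have -> : lift 0 0 = 1 :> 'I_2 by apply/val_inj.
have -> : lift 1 0 = 0 :> 'I_2 by apply/val_inj.
by rewrite !expr0 expr1 /= mul1r mulN1r mulrN.
Qed.

(** The second factor on the left is [det (1 - mu B)]. Multiplying the hypothesis on the right by
    the adjugate of [1 - mu B] and taking traces gives the identity, without any inverse. *)
Lemma mxtrace_parallel (R : realType) (B D : 'M[R]_2) (mu : R) :
  B = D *m (1%:M - mu *: B) ->
  \tr D * (mu ^+ 2 * \det B - mu * \tr B + 1) = \tr B - 2 * mu * \det B.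
Proof.
move=> BD; have E i j := congr1 (fun M : 'M[R]_2 => M i j) BD.
move: (E 0 0) (E 0 1) (E 1 0) (E 1 1); rewrite !mxtrace2 !det_mx22.
rewrite !mxE !sum_ord2 !mxE /=.
move: (B 0 0) (B 0 1) (B 1 0) (B 1 1) (D 0 0) (D 0 1) (D 1 0) (D 1 1).
move=> b00 b01 b10 b11 d00 d01 d10 d11.
move=> E1 E2 E3 E4.
(* The middle term is the trace of [D (1 - mu B) adj (1 - mu B)]; the entries of [D (1 - mu B)] are
   kept expanded so that the hypotheses turn them into entries of [B]. *)
transitivity
  ((1 - mu * b11) * (d00 * (1 - mu * b00) + d01 * (0 - mu * b10)) +
   mu * b10 * (d00 * (0 - mu * b01) + d01 * (1 - mu * b11)) +
   (mu * b01 * (d10 * (1 - mu * b00) + d11 * (0 - mu * b10)) +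
    (1 - mu * b00) * (d10 * (0 - mu * b01) + d11 * (1 - mu * b11)))); first by ring.
by rewrite -E1 -E2 -E3 -E4; ring.
Qed.

(** * Determinants of three vectors, and constancy of sign *)

Definition det3 (R : comPzRingType) (a b c : 'rV[R]_3) : R :=
  \det (col_mx a (col_mx b c)).

Lemma det3E (R : comPzRingType) (a b c : 'rV[R]_3) :
  let e (v : 'rV[R]_3) k := v 0 (inord k) in
  det3 a b c = e a 0%N * (e b 1%N * e c 2%N - e b 2%N * e c 1%N)
    - e a 1%N * (e b 0%N * e c 2%N - e b 2%N * e c 0%N)
    + e a 2%N * (e b 0%N * e c 1%N - e b 1%N * e c 0%N).
Proof.
(* Indexing by natural numbers lets the ordinals created by the cofactor expansions compute. *)
move=> e; pose f (i j : nat) := e (nth 0 [:: a; b; c] i) j.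
have -> : det3 a b c = \det (\matrix_(i < 3, j < 3) f i j).
  congr (\det _); apply/matrixP => i j; rewrite !mxE /f /e inord_val.
  case: splitP => k; rewrite ?ord1 => ->//; rewrite mxE.
  by case: splitP => l; rewrite ord1 => ->.
rewrite (expand_det_row _ 0) !big_ord_recl big_ord0 /cofactor.
rewrite !(expand_det_row _ 0) !big_ord_recl !big_ord0 /cofactor !det_mx11 !mxE.
by rewrite /f /= /bump /=; ring.
Qed.

Lemma det3_neq0 (R : fieldType) (a b c : 'rV[R]_3) :
  (det3 a b c != 0) = (\rank (col_mx a (col_mx b c)) == 3%N).
Proof.
by rewrite -[_ == 3%N]/(row_free _) row_free_unit unitmxE unitfE.
Qed.

Lemma continuous_det3 (R : realType) (T : topologicalType)
    (a b c : T -> 'rV[R]_3) t :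
  {for t, continuous a} -> {for t, continuous b} -> {for t, continuous c} ->
  {for t, continuous (fun t => det3 (a t) (b t) (c t))}.
Proof.
move=> ca cb cc.
have e (v : T -> 'rV[R]_3) (k : nat) : {for t, continuous v} ->
    {for t, continuous (fun t => v t 0 (inord k : 'I_3))}.
  by move=> cv; exact: (continuous_comp cv (@coord_continuous _ _ _ 0 _ (v t))).
have /funext -> : (fun t => det3 (a t) (b t) (c t)) =1 _ :=
  fun t => det3E (a t) (b t) (c t).
have minor p q : {for t, continuous (fun t =>
    b t 0 (inord p) * c t 0 (inord q) - b t 0 (inord q) * c t 0 (inord p))}.
  by apply: cvgB; apply: cvgM; exact: e.
by apply: cvgD; [apply: cvgB|]; apply: cvgM; first [exact: e|exact: minor].
Qed.

(** Applying a linear map to one tangent vector at a time and adding the volumes multiplies the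
    volume by the trace; here the map is [- B]. This expresses the trace through derivatives of [x]
    and [y] alone. *)
Lemma det3_shape_matrix (R : realType) (x y : 'rV[R]_2 -> 'rV[R]_3) u B :
  is_shape_matrix x y u B ->
  det3 (partial 0 y u) (partial 1 x u) (y u) +
    det3 (partial 0 x u) (partial 1 y u) (y u) =
  - \tr B * det3 (partial 0 x u) (partial 1 x u) (y u).
Proof.
move=> hB; rewrite (hB 0) (hB 1) !sum_ord2 mxtrace2 !det3E.
move: (partial 0 x u) (partial 1 x u) (y u) => a b c; rewrite !mxE.
move: (a 0 _) (a 0 (inord 1)) (a 0 (inord 2)) => a0 a1 a2.
move: (b 0 _) (b 0 (inord 1)) (b 0 (inord 2)) => b0 b1 b2.
move: (c 0 _) (c 0 (inord 1)) (c 0 (inord 2)) => c0 c1 c2.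
by move: (B 0 0) (B 0 1) (B 1 0) (B 1 1) => *; ring.
Qed.

Lemma connected_sign (R : realType) (T : topologicalType) (U : set T)
    (f : T -> R) :
  connected U -> (forall t, U t -> {for t, continuous f}) ->
  (forall t, U t -> f t != 0) ->
  (forall t, U t -> 0 < f t) \/ (forall t, U t -> f t < 0).
Proof.
move=> cU cf f0.
have /connected_intervalP itv : connected (f @` U).
  apply: connected_continuous_connected cU _; apply: continuous_in_subspaceT.
  by move=> t /set_mem; apply: cf.
apply: contrapT => /not_orP[/existsNP[a /not_implyP[Ua /negP fa]]].
move=> /existsNP[b /not_implyP[Ub /negP fb]].
have [] : (f @` U) 0 => [|t Ut ft]; last by have := f0 t Ut; rewrite ft eqxx.
apply: (itv (f a) (f b)); [by exists a|by exists b|].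
by rewrite !leNgt fa fb.
Qed.

(** * Mean curvature of the parallel surfaces, and the sign of [H] *)

Section ParallelSurface.
Variables (R : realType) (r s : nat) (U : set 'rV[R]_2).
Variables x y : 'rV[R]_2 -> 'rV[R]_3.
Hypotheses (hx : surface r.+1 U x) (hy : relative_normalization s.+1 U x y).
Local Notation H := (relative_mean_curvature x y).
Local Notation K := (relative_curvature x y).

Lemma relative_mean_curvature_parallel mu u : U u ->
  parallel_factor x y mu u != 0 ->
  relative_mean_curvature (parallel_map x y mu) y u =
  (H u - mu * K u) / parallel_factor x y mu u.
Proof.
move=> Uu.
set B := shape_matrix x y u; set M := 1%:M - mu *: B.
have AE : parallel_factor x y mu u = mu ^+ 2 * \det B - mu * \tr B + 1.
  rewrite /parallel_factor /relative_mean_curvature /relative_curvature -/B.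
  by field.
have detM : \det M = parallel_factor x y mu u.
  rewrite AE !det_mx22 mxtrace2 !mxE /=; ring.
move=> A0; have uM : M \in unitmx by rewrite unitmxE unitfE detM.
(* The parallel map is again an immersion at [u], so its shape matrix is unique and any candidate
   that satisfies the equation is the right one. *)
have fx : row_free (jac (parallel_map x y mu) u).
  rewrite (jac_parallel hx hy) // -/B -/M /row_free mxrankMfree ?jac_free //.
    by rewrite mxrank_unit.
  exact: jac_free hx _ Uu.
have hD : is_shape_matrix (parallel_map x y mu) y u (B *m invmx M).
  apply/is_shape_matrixE; rewrite (jac_parallel hx hy) // -/B -/M.
  rewrite mulmxA mulmxKV //; apply/is_shape_matrixE.
  exact: (shape_matrixP hx hy Uu).
have := @mxtrace_parallel _ B (B *m invmx M) mu; rewrite mulmxKV // -AE.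
rewrite /relative_mean_curvature (shape_matrix_eq fx hD) /relative_curvature.
move=> /(_ erefl) trD; rewrite -/B.
have -> : \tr B / 2 - mu * \det B = (\tr B - 2 * mu * \det B) / 2 by field.
by rewrite -trD mulrAC mulfK.
Qed.

(** The subset [V] allows for the removal of umbilics, where the parallel surface may be
    singular. *)
Lemma parallel_root_cmc (V : set 'rV[R]_2) mu K0 :
  V `<=` U -> mu ^+ 2 * K0 = 1 -> (forall u, V u -> K u = K0) ->
  (forall u, V u -> mu * H u != 1) ->
  parallel_cmc_on V x y mu.
Proof.
move=> VU muK hK hmu.
have mu0 : mu != 0.
  by apply: contra_eq_neq muK => ->; rewrite expr0n mul0r eq_sym oner_neq0.
have AE u : V u -> parallel_factor x y mu u = 2 * (1 - mu * H u).
  by move=> Vu; rewrite /parallel_factor hK // muK; ring.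
have A0 u : V u -> parallel_factor x y mu u != 0.
  move=> Vu; rewrite AE // mulf_neq0 ?pnatr_eq0 // subr_eq0 eq_sym; exact: hmu.
(* As [mu * K0] is the inverse of [mu], the numerator [H - mu K0] is [- (1 - mu H) / mu], which
   cancels against the factor [2 (1 - mu H)]. *)
split=> //; exists (- (2 * mu)^-1) => u Vu.
rewrite relative_mean_curvature_parallel ?A0 //; last exact: VU.
have := hmu u Vu; rewrite AE // hK // => muH.
have -> : mu * K0 = mu^-1 by apply: (mulfI mu0); rewrite mulrA -expr2 muK divff.
by field; rewrite mu0 subr_eq0 eq_sym.
Qed.

Lemma parallel_const_cmc mu c K0 :
  mu != 0 -> (forall u, U u -> K u = K0) -> (forall u, U u -> H u = c) ->
  (forall u, U u -> parallel_factor x y mu u != 0) ->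
  parallel_cmc_on U x y mu.
Proof.
move=> mu0 hK hH A0; split=> //.
exists ((c - mu * K0) / (mu ^+ 2 * K0 - 2 * mu * c + 1)) => u Uu.
rewrite relative_mean_curvature_parallel ?A0 //.
by rewrite /parallel_factor hH ?hK.
Qed.

(** Continuity of [H] is not immediate, since [shape_matrix] is obtained by choice. The proof uses
    instead [g], a polynomial in continuous coordinates that equals [H] times the positive factor
    [2 d^2] on [U]. *)
Lemma relative_mean_curvature_sign :
  connected U -> (forall u, U u -> H u != 0) ->
  (forall u, U u -> 0 < H u) \/ (forall u, U u -> H u < 0).
Proof.
move=> cU H0.
pose d u := det3 (partial 0 x u) (partial 1 x u) (y u).
pose g u := - (det3 (partial 0 y u) (partial 1 x u) (y u) +
               det3 (partial 0 x u) (partial 1 y u) (y u)) * d u.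
have gE u : U u -> g u = 2 * d u ^+ 2 * H u.
  move=> Uu; rewrite /g (det3_shape_matrix (shape_matrixP hx hy Uu)) -/(d u).
  by rewrite /relative_mean_curvature; field.
have d2 u : U u -> 0 < 2 * d u ^+ 2.
  move=> Uu; rewrite mulr_gt0 // exprn_even_gt0 //= det3_neq0.
  by have [_ /(_ u Uu) [/eqP]] := hy.
have cx i u : U u -> {for u, continuous (partial i x)}.
  by have [[_ /(_ i) [_ px]] _ _ _] := hx; case: r px => [|?] [cp _] /cp.
have cy i u : U u -> {for u, continuous (partial i y)}.
  by have [[_ /(_ i) [_ py]] _] := hy; case: s py => [|?] [cp _] /cp.
have cy0 u : U u -> {for u, continuous y} by case: hy => -[+ _] _; apply.
have cg u : U u -> {for u, continuous g}.
  move=> Uu; apply: continuousM; last by apply: continuous_det3; auto.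
  by apply/continuousN/continuousD; apply: continuous_det3; auto.
have [u Uu|g0|g0] := connected_sign cU cg.
- by rewrite gE // mulf_neq0 ?H0 // gt_eqF ?d2.
- by left=> u Uu; have := g0 u Uu; rewrite gE // pmulr_rgt0 ?d2.
- by right=> u Uu; have := g0 u Uu; rewrite gE // pmulr_rlt0 ?d2.
Qed.

End ParallelSurface.

Theorem proposition3p1 (R : realType) (r s : nat) (U : set 'rV[R]_2)
    (x y : 'rV[R]_2 -> 'rV[R]_3) (K0 : R)
    (hr : (3 <= r)%N) (hs : (1 <= s)%N) (hrs : (s < r)%N)
    (hU : region U)
    (hx : surface r U x)
    (hy : relative_normalization s U x y)
    (hreal : forall u, U u ->
       0 <= relative_mean_curvature x y u ^+ 2 - relative_curvature x y u)
    (hK0 : 0 < K0)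
    (hK : forall u, U u -> relative_curvature x y u = K0) :
  exists mu1 mu2 : R,
    [/\ mu1 != mu2,
        parallel_cmc_on U x y mu1 &
        parallel_cmc_on (U `\` exceptional_umbilics U x y) x y mu2].
Proof.
case: r hr hrs hx => // r' _ _ hx'; case: s hs hy => // s' _ hy'.
set H := relative_mean_curvature x y.
have H0 u : U u -> H u != 0.
  move=> Uu; have := hreal u Uu; rewrite hK // subr_ge0 => KH.
  by apply: contraTneq KH => H0; rewrite -/H H0 expr0n -ltNge.
have [_ _ cU] := hU.
(* [m] is the root with the sign of [H]; then [- m * H] is negative, hence never 1, and [- m] is a
   distance that works on all of [U]. *)
have [m [mK mH]] : exists m, m ^+ 2 * K0 = 1 /\ forall u, U u -> 0 < m * H u.
  have q0 : 0 < Num.sqrt K0 by rewrite sqrtr_gt0.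
  have q2 : (Num.sqrt K0)^-1 ^+ 2 * K0 = 1.
    by rewrite exprVn sqr_sqrtr ?ltW // mulVf ?gt_eqF.
  have [Hp|Hn] := relative_mean_curvature_sign hx' hy' cU H0.
    by exists (Num.sqrt K0)^-1; split=> // u /Hp; apply: mulr_gt0; rewrite invr_gt0.
  exists (- (Num.sqrt K0)^-1); split; first by rewrite sqrrN.
  by move=> u /Hn Hu; rewrite nmulr_rgt0 // oppr_lt0 invr_gt0.
have m0 : m != 0.
  by apply: contra_eq_neq mK => ->; rewrite expr0n mul0r eq_sym oner_neq0.
have cmc1 : parallel_cmc_on U x y (- m).
  apply: (parallel_root_cmc hx' hy' _ _ hK) => [//||u Uu]; first by rewrite sqrrN.
  by apply/eqP => E; have := mH u Uu; rewrite /H; lra.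
exists (- m).
have [[c hc]|nc] := pselect (constant_on U H).
  (* At distance [- m / 2] the factor is [1/4 + m H + 1 > 0]; the halving only serves to differ from
     [- m]. With [H] constant, the exceptional set is empty. *)
  exists (- m / 2); split; [|exact: cmc1|].
  - by apply/eqP => E; move/eqP: m0; apply; lra.
  - have -> : U `\` exceptional_umbilics U x y = U.
      by apply/seteqP; split=> [u []//|u Uu]; split=> // -[_ _]; apply; exists c.
    apply: (parallel_const_cmc hx' hy' _ hK hc) => [|u Uu].
      by rewrite mulf_neq0 ?oppr_eq0 // invr_eq0.
    rewrite /parallel_factor hK // gt_eqF //.
    have := mH u Uu; rewrite /H; nra.
exists m; split; [|exact: cmc1|].
  by apply/eqP => E; move/eqP: m0; apply; lra.
apply: (parallel_root_cmc hx' hy' _ mK) => [u []//|u [Uu _]|u [Uu nu]].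
  exact: hK.
(* Squaring [m H = 1] gives [m^2 H^2 = 1 = m^2 K0], so [u] would be one of the umbilics removed. *)
apply/eqP => E; apply: nu; split=> //.
have mm0 : m ^+ 2 != 0 by rewrite expf_neq0.
by apply: (mulfI mm0); rewrite -exprMn E hK // mK expr1n.
Qed.
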